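(* Let $n$ be a composite number, let $\omega = e^{2\pi\sqrt{-1}/n}$, and let $P(z)$ be a non-zero polynomial with complex coefficients with $\deg P(z) \leq n-1$. Suppose that exactly $k$ different $n$-th roots of unity (i.e. complex numbers $\zeta$ with $\zeta^n=1$) are roots of $P(z)$. Then $$w(P) \geq \frac{n}{n-k}.$$ Furthermore, equality $w(P) = \frac{n}{n-k}$ holds if and only if there exist a positive integer $r$ dividing $n$, an integer $l$ with $0 \leq l \leq r-1$, an integer $j$ with $0\leq j\leq n-1$, and a complex number $\alpha$ such that $$P(z) = \alpha\, D_{n,r,l}(\omega^j z).$$
   Context: For a complex polynomial $P(z)$, $w(P)$ denotes the number of non-zero coefficients of $P(z)$. For a positive integer $r$ dividing $n$ and an integer $l$ with $0\leq l\leq r-1$, define the polynomial $$D_{n,r,l}(z) = z^l\left(1+z^r+z^{2r}+\dots+z^{(\frac{n}{r}-1)r}\right).$$ *)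

(* Defs.v *)
From mathcomp Require Import all_boot all_order all_algebra.
From mathcomp Require Import all_classical all_reals all_analysis.
From mathcomp Require Import complex.

Set Implicit Arguments.
Unset Strict Implicit.
Unset Printing Implicit Defensive.

Import Order.TTheory GRing.Theory Num.Theory.

Local Open Scope ring_scope.
Local Open Scope complex_scope.

Definition composite (n : nat) : bool := (1 < n)%N && ~~ prime n.

Definition weight (R : nzRingType) (P : {poly R}) : nat :=
  count (fun c => c != 0) P.

Definition Dpoly (R : nzRingType) (n r l : nat) : {poly R} :=
  'X^l * \sum_(m < (n %/ r)%N) 'X^(m * r)%N.

(* e^{2 pi i / n}, through Euler's formula *)
Definition omega (R : realType) (n : nat) : R[i] :=
  cos (2 * pi / n%:R) +i* sin (2 * pi / n%:R).

Definition unity_roots_of (R : realType) (n : nat) (P : {poly R[i]}) :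
    set R[i] :=
  [set z | z ^+ n = 1 /\ root P z]%classic.

(* Main.v *)
Require Import Defs.
From mathcomp Require Import all_boot all_order all_algebra.
From mathcomp Require Import all_classical all_reals all_analysis.
From mathcomp Require Import complex zify ring lra.

Import Order.TTheory GRing.Theory Num.Theory.

Local Open Scope ring_scope.
Local Open Scope complex_scope.
Local Open Scope card_scope.

Set Implicit Arguments.
Unset Strict Implicit.

(** Write w for the weight of P and N for the number of n-th roots of unity at
which P does not vanish, so that N = n - k. The inequality is w * N >= n, the
uncertainty principle for the cyclic group of order n.

A nonzero polynomial of degree less than n with w nonzero coefficients cannot
vanish at w consecutive powers of a primitive n-th root of unity z
([consecutive_roots_eq0]): otherwise P(z X) - z^s P(X), with s the degree of P,
would have one term less and vanish at w - 1 consecutive powers. Hence each of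
the n cyclic windows of w consecutive exponents contains an exponent i with
P(z^i) != 0. Every such exponent lies in exactly w windows, which gives
n <= w * N ([windows_leq]).

If w * N = n, then every window contains exactly one such exponent. Comparing
two adjacent windows shows that these exponents form a progression i0 + w Z
([windows_eq]). After the rotation Q(X) = P(z^i0 X), the values Q(z^i) vanish
exactly when w does not divide i. Put r = n / w. The polynomial (X^r - 1) Q
vanishes at all n-th roots of unity, so it is divisible by
X^n - 1 = (X^r - 1) (1 + X^r + ... + X^((w-1) r)); thus
Q = E * (1 + X^r + ... + X^((w-1) r)) with deg E < r ([geom_dvdp]). The shifted
copies of E do not overlap, so the weight of Q is w times that of E
([weight_mul_geom]). As this weight is w, E is a monomial a X^l, and P is a
rotation of a D_{n,r,l} ([Dpoly_of_extremal]). The converse is a direct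
computation of the weight and of the zeros of D_{n,r,l}
([extremal_of_Dpoly]). *)

(** * The weight of a polynomial *)

Lemma weightE (R : nzRingType) (p : {poly R}) (N : nat) :
  (size p <= N)%N -> weight p = (\sum_(i < N) ((p`_i)%R != 0%R))%N.
Proof.
move=> szp; rewrite /weight -sum1_count (big_nth 0) big_mkord big_mkcond /=.
rewrite (eq_bigr (fun i : 'I__ => nat_of_bool (p`_i != 0))); last first.
  by move=> i _; case: (_ != _).
rewrite (big_ord_widen N (fun i => nat_of_bool (p`_i != 0)) szp) big_mkcond /=.
apply: eq_bigr => i _; case: ltnP => // szi.
by rewrite nth_default ?eqxx.
Qed.

Lemma leq_weight (R : nzRingType) (p q : {poly R}) :
  (forall i, p`_i = 0 -> q`_i = 0) -> (weight q <= weight p)%N.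
Proof.
move=> pq; pose N := maxn (size p) (size q).
rewrite (@weightE _ p N) ?leq_maxl // (@weightE _ q N) ?leq_maxr //.
apply: leq_sum => i _; have [/pq -> | _] := eqVneq p`_i 0; first by rewrite eqxx.
exact: leq_b1.
Qed.

Lemma weight_eq0 (R : nzRingType) (p : {poly R}) : weight p = 0%N -> p = 0.
Proof.
move=> w0; apply/eqP/negPn; rewrite -size_poly_gt0; apply/negP => sz.
move: w0; rewrite (weightE (leqSpred _)) big_ord_recr /=.
by rewrite -lead_coefE lead_coef_eq0 -size_poly_gt0 sz addn1.
Qed.

Lemma weight_lead (R : nzRingType) (p : {poly R}) : p != 0 ->
  weight p = (weight (p - lead_coef p *: 'X^((size p).-1))).+1.
Proof.
move=> p0; have sz : (0 < size p)%N by rewrite size_poly_gt0.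
have szB : (size (p - lead_coef p *: 'X^((size p).-1))%R <= size p)%N.
  apply: (leq_trans (size_polyD _ _)); rewrite size_polyN geq_max leqnn /=.
  by apply: (leq_trans (size_scale_leq _ _)); rewrite size_polyXn prednK.
rewrite (weightE (leq_trans szB (leqSpred _))) (weightE (leqSpred _)).
rewrite !big_ord_recr /= coefB coefZ coefXn eqxx mulr1.
rewrite -lead_coefE subrr eqxx lead_coef_eq0 p0 addn1 addn0; congr (_.+1).
apply: eq_bigr => i _.
by rewrite coefB coefZ coefXn ltn_eqF ?mulr0 ?subr0.
Qed.

Lemma weight1_monomial (R : nzRingType) (p : {poly R}) :
  weight p = 1%N -> p = lead_coef p *: 'X^((size p).-1).
Proof.
move=> w1; have p0 : p != 0.
  by apply/eqP => p0; move: w1; rewrite p0 /weight polyseq0.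
move: w1; rewrite (weight_lead p0) => -[] /weight_eq0 /eqP.
by rewrite subr_eq0 => /eqP.
Qed.

(** Adding X^r q to a polynomial of degree less than r makes no two terms
collide. *)
Lemma weight_shiftD (R : nzRingType) (p q : {poly R}) (r : nat) :
  (size p <= r)%N -> weight (p + q * 'X^r) = (weight p + weight q)%N.
Proof.
move=> szp; have szS : (size (p + q * 'X^r)%R <= r + size q)%N.
  apply: (leq_trans (size_polyD _ _)); rewrite geq_max.
  rewrite (leq_trans szp) ?leq_addr //=.
  by apply: (leq_trans (size_polyMleq _ _)); rewrite size_polyXn addnS addnC.
rewrite (weightE szS) (weightE szp) (weightE (leqnn (size q))) big_split_ord /=.
congr (_ + _)%N; apply: eq_bigr => i _; rewrite coefD coefMXn.
  by rewrite ltn_ord addr0.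
rewrite ltnNge leq_addr /= addnC addnK nth_default ?add0r //.
by rewrite (leq_trans szp) ?leq_addl.
Qed.

(** The product is a juxtaposition of m disjoint copies of p, shifted by
multiples of r. *)
Lemma weight_mul_geom (R : nzRingType) (p : {poly R}) (r m : nat) :
  (size p <= r)%N -> weight (p * \sum_(i < m) 'X^(i * r)) = (m * weight p)%N.
Proof.
move=> szp; elim: m => [|m IH].
  by rewrite big_ord0 mulr0 /weight polyseq0.
rewrite mulSn -IH -(weight_shiftD _ szp); congr weight.
rewrite big_ord_recl /= mul0n expr0 mulrDr mulr1; congr (_ + _).
rewrite -mulrA; congr (_ * _); rewrite mulr_suml; apply: eq_bigr => i _.
by rewrite -exprD addnC -mulSn.
Qed.

(** * Rotation of the variable *)

Lemma coef_compZX (F : comNzRingType) (p : {poly F}) (c : F) i :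
  (p \Po (c *: 'X))`_i = c ^+ i * p`_i.
Proof.
rewrite coef_comp_poly.
under eq_bigr do rewrite exprZn coefZ coefXn.
have [szi | szi] := ltnP i (size p).
  rewrite (bigD1 (Ordinal szi)) //= eqxx mulr1 mulrC big1 ?addr0 // => j.
  by rewrite -val_eqE /= eq_sym => /negPf ->; rewrite !mulr0.
rewrite [p`_i]nth_default // mulr0 big1 // => j _.
by rewrite gtn_eqF ?mulr0 // (leq_trans (ltn_ord j)).
Qed.

Lemma weight_compZX (F : fieldType) (p : {poly F}) (c a : F) :
  c != 0 -> a != 0 -> weight (a *: (p \Po (c *: 'X))) = weight p.
Proof.
move=> c0 a0; apply/eqP; rewrite eqn_leq !leq_weight // => i.
  rewrite coefZ coef_compZX => /eqP; rewrite !mulf_eq0 (negPf a0) /=.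
  by rewrite (negPf (expf_neq0 _ c0)) => /eqP.
by rewrite coefZ coef_compZX => ->; rewrite !mulr0.
Qed.

Lemma horner_compZX (F : comNzRingType) (p : {poly F}) (c x : F) :
  (p \Po (c *: 'X)).[x] = p.[c * x].
Proof. by rewrite horner_comp hornerZ hornerX. Qed.

Lemma compZXK (F : fieldType) (p : {poly F}) (c d : F) : c * d = 1 ->
  (p \Po (c *: 'X)) \Po (d *: 'X) = p.
Proof.
move=> cd; apply/polyP => i.
by rewrite !coef_compZX mulrA -exprMn [d * c]mulrC cd expr1n mul1r.
Qed.

(** * Zeros at consecutive powers of a primitive root *)

(** By induction on the weight: with s the degree of p, the combination
p(z X) - z^s p(X) loses the leading term of p, keeps the other terms because
the powers of z below n are distinct, and vanishes at the same points but the
last. So it is zero, p is a monomial, and a monomial does not vanish at x. *)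
Lemma consecutive_roots_eq0 (F : fieldType) (n : nat) (z : F) (p : {poly F}) x :
  n.-primitive_root z -> (size p <= n)%N -> x != 0 ->
  (forall i, (i < weight p)%N -> root p (x * z ^+ i)) -> p = 0.
Proof.
move=> prz szp x0; have [m] := ubnP (weight p).
elim: m p szp => // m IH p szp wp rootp.
have [//|p0] := eqVneq p 0.
have sz : (0 < size p)%N by rewrite size_poly_gt0.
have wL := weight_lead p0; set s := (size p).-1 in wL.
pose q := p \Po (z *: 'X) - z ^+ s *: p.
have qE i : q`_i = (z ^+ i - z ^+ s) * p`_i.
  by rewrite coefB coefZ coef_compZX mulrBl.
have wq : (weight q <= (weight p).-1)%N.
  rewrite wL /=; apply: leq_weight => i; rewrite coefB coefZ coefXn qE.
  case: eqP => [-> | _]; first by rewrite subrr mul0r.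
  by rewrite mulr0 subr0 => ->; rewrite mulr0.
have q0 : q = 0.
  apply: IH.
  - rewrite (leq_trans _ szp) //; apply/leq_sizeP => j szj.
    by rewrite qE nth_default ?mulr0.
  - by rewrite wL ltnS in wp; apply: leq_trans wp; rewrite ltnS (leq_trans wq) ?wL.
  - move=> i iq; have ip : (i.+1 < weight p)%N.
      by rewrite wL ltnS (leq_trans iq) // (leq_trans wq) ?wL.
    rewrite /root hornerD hornerN hornerZ horner_compZX.
    rewrite mulrCA -exprS (rootP (rootp _ ip)) (rootP (rootp _ (ltnW ip))).
    by rewrite mulr0 subr0.
(* q = 0 annihilates every coefficient p`_i with z ^+ i != z ^+ s. *)
have pE : p = lead_coef p *: 'X^s.
  apply/polyP => i; rewrite coefZ coefXn.
  case: eqP => [->|/eqP ni]; first by rewrite mulr1.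
  rewrite mulr0; have [szi | szi] := ltnP i (size p); last by rewrite nth_default.
  have := qE i; rewrite q0 coef0 => /esym/eqP; rewrite mulf_eq0 subr_eq0.
  rewrite (eq_prim_root_expr prz) !modn_small ?(negPf ni) //=.
  - by move/eqP.
  - by apply: leq_trans szp; rewrite prednK.
  - exact: leq_trans szp.
have := rootp 0%N; rewrite wL => /(_ isT); rewrite expr0 mulr1 pE /root.
rewrite hornerZ hornerXn mulf_eq0 lead_coef_eq0 (negPf p0) expf_eq0.
by rewrite (negPf x0) andbF.
Qed.

(** * Double counting over cyclic windows *)

Lemma sum_periodic_shift (n : nat) (f : nat -> nat) (j : nat) :
  (forall i, f (i + n)%N = f i) ->
  (\sum_(i < n) f (i + j) = \sum_(i < n) f i)%N.
Proof.
move=> fper; elim: j => [|j IH]; first by under eq_bigr do rewrite addn0.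
case: n fper IH => [|n] fper IH; first by rewrite !big_ord0.
rewrite -IH big_ord_recr [RHS]big_ord_recl /= addnC add0n.
congr (_ + _)%N; first by rewrite addnS -addSn addnC fper.
by apply: eq_bigr => i _; rewrite /bump /= addnS add1n addSn.
Qed.

(** Each index of a period belongs to exactly w of the cyclic windows. *)
Lemma sum_windows (n w : nat) (f : nat -> nat) :
  (forall i, f (i + n)%N = f i) ->
  (\sum_(i < n) \sum_(j < w) f (i + j) = w * \sum_(i < n) f i)%N.
Proof.
move=> fper; rewrite exchange_big /=.
under eq_bigr do rewrite sum_periodic_shift //.
by rewrite sum_nat_const card_ord.
Qed.

Lemma windows_leq (n w : nat) (f : nat -> nat) :
  (forall i, f (i + n)%N = f i) ->
  (forall i, 0 < \sum_(j < w) f (i + j))%N ->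
  (n <= w * \sum_(i < n) f i)%N.
Proof.
move=> fper fw; rewrite -sum_windows // -{1}(card_ord n) -sum1_card.
exact: leq_sum.
Qed.

(** In the extremal case all window sums are 1. The windows starting at i and at
i + 1 share all indices but i and i + w, so f is w-periodic; the window that
starts at an index where f is nonzero then shows that f vanishes at the other
indices of one w-period. *)
Lemma windows_eq (n w : nat) (f : nat -> nat) : (0 < n)%N ->
  (forall i, f (i + n)%N = f i) ->
  (forall i, 0 < \sum_(j < w) f (i + j))%N ->
  n = (w * \sum_(i < n) f i)%N ->
  exists i0, forall t, f (i0 + t)%N = (w %| t)%N.
Proof.
move=> n0 fper fw nE.
have per_mul d : (forall i, f (i + d)%N = f i) ->
    forall m i, f (i + m * d)%N = f i.
  by move=> perd; elim=> [|m IH] i; rewrite ?addn0 // mulSn addnCA addnC perd.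
have fper_mod i t : f (i %% n + t)%N = f (i + t)%N.
  by rewrite {2}(divn_eq i n) -addnA [(_ * n + _)%N]addnC per_mul.
have w1 i : (\sum_(j < w) f (i + j) = 1)%N.
  under eq_bigr do rewrite -fper_mod.
  pose o := Ordinal (ltn_pmod i n0); rewrite -[(i %% n)%N]/(val o).
  have rest : (n.-1 <= \sum_(k < n | k != o) \sum_(j < w) f (k + j))%N.
    rewrite -{1}(card_ord n) -(cardC1 o) -sum1_card.
    exact: leq_sum.
  have := sum_windows w fper; rewrite -nE (bigD1 o) //=.
  have := fw (i %% n)%N.
  set S := (\sum_(k < n | _) _)%N in rest *.
  set T := (\sum_(j < w) _)%N; move: S T rest => S T; clear -n0; lia.
have fperw i : f (i + w)%N = f i.
  have : (\sum_(j < w.+1) f (i + j) = \sum_(j < w.+1) f (i + j))%N by [].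
  rewrite {1}big_ord_recl big_ord_recr /= w1.
  under eq_bigr do rewrite /bump add1n addnS -addSn.
  by rewrite w1 addn0; lia.
have w0 : (0 < w)%N by move: (fw 0%N); case: (w) => //; rewrite big_ord0.
have [i0 fi0] : exists i0, (0 < f i0)%N.
  have : (\sum_(j < w) f (0 + j) != 0)%N by rewrite w1.
  by rewrite sum_nat_eq0 negb_forall => /existsP[j]; rewrite -lt0n add0n; exists j.
exists i0 => t.
have -> : f (i0 + t)%N = f (i0 + t %% w)%N.
  by rewrite {1}(divn_eq t w) [(_ * w + _)%N]addnC addnA per_mul.
have := w1 i0; rewrite (bigD1 (Ordinal w0)) //= addn0 /dvdn.
have [-> | tw] := eqVneq (t %% w)%N 0%N; first by rewrite addn0; lia.
rewrite (bigD1 (Ordinal (ltn_pmod t w0))) //=; lia.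
Qed.

(** * Values at the roots of unity *)

Lemma card_eq_seq (T : choiceType) (x0 : T) (s : seq T) : uniq s ->
  [set x | x \in s]%classic #= `I_(size s).
Proof.
move=> us; rewrite card_eq_sym.
have -> : [set x | x \in s]%classic = [set nth x0 s i | i in `I_(size s)]%classic.
  apply/seteqP; split=> x /=; last by move=> [i si <-]; rewrite mem_nth.
  by move=> xs; exists (index x s); rewrite ?nth_index //= index_mem.
rewrite card_eq_sym; apply: inj_card_eq => i j; rewrite !inE /= => si sj /eqP.
by rewrite nth_uniq // => /eqP.
Qed.

Definition nonzero_at (F : fieldType) (z : F) (p : {poly F}) (i : nat) : bool :=
  p.[z ^+ i] != 0.

Lemma nonzero_at_periodic (F : fieldType) (n : nat) (z : F) p :
  n.-primitive_root z -> forall i, nonzero_at z p (i + n) = nonzero_at z p i.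
Proof. by move=> prz i; rewrite /nonzero_at exprD (prim_expr_order prz) mulr1. Qed.

Lemma unity_roots_count (F : fieldType) (n k : nat) (z : F) (p : {poly F}) :
  n.-primitive_root z ->
  [set x | x ^+ n = 1 /\ root p x]%classic #= `I_k ->
  (k + \sum_(i < n) nonzero_at z p i = n)%N.
Proof.
move=> prz; pose s := [seq x <- [seq z ^+ i | i <- iota 0 n] | root p x].
have us : uniq s.
  rewrite filter_uniq // map_inj_in_uniq ?iota_uniq // => i j.
  rewrite !mem_iota /= !add0n => ni nj /eqP.
  by rewrite (eq_prim_root_expr prz) !modn_small // => /eqP.
have -> : [set x | x ^+ n = 1 /\ root p x]%classic = [set x | x \in s]%classic.
  apply/seteqP; split=> x /=; rewrite mem_filter.
    move=> [/(prim_rootP prz)[i ->] ->] /=; apply: map_f.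
    by rewrite mem_iota add0n /=.
  move=> /andP[-> /mapP[i _ ->]]; split=> //.
  by rewrite exprAC (prim_expr_order prz) expr1n.
rewrite (card_eql (card_eq_seq 0 us)) => /card_eq_II <-.
rewrite size_filter count_map -sum1_count big_mkcond /=.
have -> : iota 0 n = index_iota 0 n by rewrite /index_iota subn0.
rewrite big_mkord -big_split /= -[RHS]card_ord -sum1_card; apply: eq_bigr => i _.
by rewrite /root /nonzero_at; case: eqP.
Qed.

Lemma weight_windows (F : fieldType) (n : nat) (z : F) (p : {poly F}) :
  n.-primitive_root z -> p != 0 -> (size p <= n)%N ->
  forall i, (0 < \sum_(j < weight p) nonzero_at z p (i + j))%N.
Proof.
move=> prz p0 szp i; rewrite lt0n; apply: contra p0.
rewrite sum_nat_eq0 => /forallP zj; apply/eqP.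
have z0 : z != 0 by rewrite (prim_root_eq0 prz) -lt0n (prim_order_gt0 prz).
apply: (consecutive_roots_eq0 prz szp (expf_neq0 i z0)) => j ltj.
rewrite -exprD /root; have := zj (Ordinal ltj); rewrite /nonzero_at /=.
by case: (_ == 0).
Qed.

(** * Equality case *)

(** The factor X^r - 1 vanishes at z^i when m divides i, and p vanishes at the
other powers of z, so their product is divisible by X^n - 1; cancelling
X^r - 1 leaves the geometric sum. *)
Lemma geom_dvdp (F : fieldType) (n r m : nat) (z : F) (p : {poly F}) :
  n.-primitive_root z -> n = (r * m)%N ->
  (forall i, nonzero_at z p i = (m %| i)%N) ->
  (\sum_(i < m) 'X^(i * r) %| p)%R.
Proof.
move=> prz nE pz; have := prim_order_gt0 prz; rewrite nE muln_gt0 => /andP[r0 m0].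
have X0 : 'X^r - 1 != 0 :> {poly F} by rewrite -size_poly_gt0 size_XnsubC.
rewrite -(@dvdp_mul2l _ ('X^r - 1)) //.
under eq_bigr do rewrite mulnC exprM.
rewrite -subrX1 -exprM -nE -(factor_Xn_sub_1 prz).
rewrite -(big_map (fun i => z ^+ i) xpredT (fun a => 'X - a%:P)).
apply: uniq_roots_dvdp.
  apply/allP => x /mapP[i _ ->]; rewrite /root hornerM mulf_eq0 hornerD hornerN.
  rewrite hornerXn hornerC; have := pz i; rewrite /nonzero_at.
  case: (boolP (m %| i)%N) => [/dvdnP[q ->] _ | _ /negbFE ->]; last first.
    by rewrite orbT.
  rewrite -exprM -mulnA [(m * r)%N]mulnC -nE mulnC exprM.
  by rewrite (prim_expr_order prz) expr1n subrr eqxx.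
rewrite uniq_rootsE map_inj_in_uniq ?iota_uniq // => i j.
rewrite !mem_iota /= !add0n subn0 => ni nj /eqP.
by rewrite (eq_prim_root_expr prz) !modn_small // => /eqP.
Qed.

(** Adding r avoids a truncated subtraction: the sum has degree r * m - r. *)
Lemma size_geom (F : fieldType) (r m : nat) : (0 < r)%N -> (0 < m)%N ->
  (size (\sum_(i < m) 'X^(i * r) : {poly F})%R + r = (r * m).+1)%N.
Proof.
move=> r0 m0; have X0 : 'X^r - 1 != 0 :> {poly F} by rewrite -size_poly_gt0 size_XnsubC.
have E : ('X^r - 1) * \sum_(i < m) 'X^(i * r) = 'X^(r * m) - 1 :> {poly F}.
  by rewrite exprM [RHS]subrX1; congr (_ * _); apply: eq_bigr => i _; rewrite mulnC exprM.
have S0 : \sum_(i < m) 'X^(i * r) != 0 :> {poly F}.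
  apply: contra_eq_neq E => ->; rewrite mulr0 eq_sym -size_poly_gt0 size_XnsubC //.
  by rewrite muln_gt0 r0.
by rewrite -(@size_XnsubC F _ 1) ?muln_gt0 ?r0 // -E size_mul // size_XnsubC // addnC.
Qed.

Lemma Dpoly_weight (F : fieldType) (n r l : nat) : (l < r)%N ->
  weight (Dpoly F n r l) = (n %/ r)%N.
Proof.
move=> lr; rewrite /Dpoly weight_mul_geom ?size_polyXn //.
have := @weight_lead F 'X^l; rewrite monic_neq0 ?monicXn // => /(_ isT) ->.
by rewrite lead_coefXn size_polyXn scale1r subrr /weight polyseq0 muln1.
Qed.

(** At x = z^i the value is a power of x times a geometric sum of ratio x^r.
This sum is the nonzero number n / r if x^r = 1, and otherwise it vanishes
because x^n = 1. *)
Lemma Dpoly_nonzero_at (F : fieldType) (n r l : nat) (z : F) i :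
  n.-primitive_root z -> (r %| n)%N ->
  nonzero_at z (Dpoly F n r l) i = (n %/ r %| i)%N.
Proof.
move=> prz rn; have n0 := prim_order_gt0 prz; have nE := divnK rn.
have z0 : z != 0 by rewrite (prim_root_eq0 prz) -lt0n.
have r0 : (0 < r)%N by apply: dvdn_gt0 rn.
rewrite /nonzero_at hornerM hornerXn mulf_eq0 (negPf (expf_neq0 _ (expf_neq0 _ z0))) /=.
rewrite horner_sum; under eq_bigr do rewrite hornerXn mulnC exprM.
rewrite -[RHS](@dvdn_pmul2r r) // nE (prim_order_dvd prz) exprM.
have [-> | zr] := eqVneq (z ^+ i ^+ r) 1.
  under eq_bigr do rewrite expr1n.
  rewrite sumr_const card_ord (prim_root_dvd_eq0 prz) //.
  by rewrite -{2}nE dvdn_mulr.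
apply/negbTE; rewrite negbK.
have := subrX1 (z ^+ i ^+ r) (n %/ r).
rewrite -(exprM (z ^+ i)) [(r * _)%N]mulnC nE exprAC (prim_expr_order prz) expr1n subrr.
by move=> /esym/eqP; rewrite mulf_eq0 subr_eq0 (negPf zr).
Qed.

(** The rotation by z^i0 moves the progression of nonvanishing exponents to the
multiples of the weight w; the quotient e by the geometric sum then has degree
less than r = n / w and weight 1, so it is a monomial. *)
Lemma Dpoly_of_extremal (F : fieldType) (n : nat) (z : F) (p : {poly F}) :
  n.-primitive_root z -> p != 0 -> (size p <= n)%N ->
  n = (weight p * \sum_(i < n) nonzero_at z p i)%N ->
  exists (r l j : nat) (alpha : F),
    [/\ (0 < r)%N, (r %| n)%N, (l < r)%N, (j < n)%N
      & p = alpha *: (Dpoly F n r l \Po (z ^+ j *: 'X))].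
Proof.
move=> prz p0 szp nE; have n0 := prim_order_gt0 prz.
have z0 : z != 0 by rewrite (prim_root_eq0 prz) -lt0n.
have [i0 pi0] := windows_eq n0
  (fun i => congr1 nat_of_bool (nonzero_at_periodic p prz i))
  (weight_windows prz p0 szp) nE.
move: nE; set w := weight p in pi0 *; move: (\sum_(i < n) _)%N => r nE.
have /andP[w0 r0] : (0 < w)%N && (0 < r)%N by rewrite -muln_gt0 -nE.
pose q := p \Po (z ^+ i0 *: 'X).
have qz t : nonzero_at z q t = (w %| t)%N.
  by apply: (can_inj oddb); rewrite -pi0 /nonzero_at horner_compZX -exprD.
have szq : (size q <= n)%N.
  apply/leq_sizeP => i ni; rewrite coef_compZX nth_default ?mulr0 //.
  exact: leq_trans szp ni.
have q0 : q != 0.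
  by apply/eqP => q0; have := qz 0%N; rewrite /nonzero_at q0 horner0 eqxx dvdn0.
have wq : weight q = w.
  by rewrite -[q]scale1r weight_compZX ?oner_eq0 // expf_neq0.
have nE' : n = (r * w)%N by rewrite mulnC.
have /dvdpP[e qE] := geom_dvdp prz nE' qz.
have e0 : e != 0 by apply: contra_neq q0 => e0; rewrite qE e0 mul0r.
have sze : (size e <= r)%N.
  have G0 : \sum_(i < w) 'X^(i * r) != 0 :> {poly F}.
    by apply: contra_neq q0 => G0; rewrite qE G0 mulr0.
  have arith (a b c d : nat) :
      (0 < a -> (a + b).-1 <= c -> b + d = c.+1 -> a <= d)%N.
    by clear; lia.
  apply: (arith _ _ (r * w)%N _ _ _ (size_geom F r0 w0)).
    by rewrite size_poly_gt0.
  by rewrite -size_mul // -qE -nE'.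
have e1 : weight e = 1%N.
  move: wq; rewrite qE weight_mul_geom // => /eqP.
  by rewrite -{2}[w]muln1 eqn_pmul2l // => /eqP.
(* The exponent j represents - i0 modulo n, so that z ^+ j undoes the rotation
   by z ^+ i0. *)
exists r, (size e).-1, ((n - i0 %% n) %% n)%N, (lead_coef e); split=> //.
- by rewrite nE dvdn_mull.
- by rewrite prednK // size_poly_gt0.
- by rewrite ltn_pmod.
have zz : z ^+ i0 * z ^+ ((n - i0 %% n) %% n) = 1.
  rewrite (prim_expr_mod prz) -(prim_expr_mod prz i0) -exprD.
  rewrite subnKC ?(prim_expr_order prz) //.
  by rewrite ltnW // ltn_pmod.
rewrite -[LHS](compZXK p zz) -comp_polyZ -/q qE {1}(weight1_monomial e1).
by rewrite /Dpoly nE mulnK // scalerAl.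
Qed.

Lemma extremal_of_Dpoly (F : fieldType) (n r l j : nat) (z alpha : F) :
  n.-primitive_root z -> alpha != 0 -> (r %| n)%N -> (l < r)%N ->
  let p := alpha *: (Dpoly F n r l \Po (z ^+ j *: 'X)) in
  (weight p * \sum_(i < n) nonzero_at z p i = n)%N.
Proof.
move=> prz a0 rn lr p; have n0 := prim_order_gt0 prz.
have z0 : z != 0 by rewrite (prim_root_eq0 prz) -lt0n.
rewrite weight_compZX ?expf_neq0 // Dpoly_weight //.
pose f i := nat_of_bool (n %/ r %| i)%N.
have fper i : f (i + n)%N = f i.
  by rewrite /f dvdn_addl // -{2}(divnK rn) dvdn_mulr.
have -> : (\sum_(i < n) nonzero_at z p i = \sum_(i < n) f (i + j))%N.
  apply: eq_bigr => i _; rewrite /f -(Dpoly_nonzero_at l _ prz rn) /nonzero_at.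
  by rewrite hornerZ horner_compZX mulf_eq0 (negPf a0) -exprD addnC.
rewrite sum_periodic_shift // -(sum_periodic_shift 1 fper).
(* The count of the multiples of n / r runs over 1, ..., n, whence the shift by
   one. *)
under eq_bigr do rewrite addn1.
have := divn_count_dvd (n %/ r) n; rewrite big_add1 big_mkord => <-.
by rewrite mulnC divnK // -{2}(divnK rn) dvdn_mulr.
Qed.

(** * The complex root of unity *)

Lemma deMoivre (R : realType) (x : R) m :
  (cos x +i* sin x) ^+ m = cos (m%:R * x) +i* sin (m%:R * x).
Proof.
elim: m => [|m IH]; first by rewrite expr0 mul0r cos0 sin0.
rewrite exprS IH -natr1 mulrDl mul1r cosD sinD; apply/eqP; rewrite eq_complex /=.
by apply/andP; split; apply/eqP; ring.
Qed.

Lemma cos_lt1 (R : realType) (x : R) : 0 < x < 2 * pi -> cos x < 1.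
Proof.
move=> /andP[x0 x2].
have -> : x = (x / 2) *+ 2 by rewrite -mulr_natr divfK.
rewrite cos_mulr2n cos2sin2.
have : 0 < sin (x/2).
  by apply: sin_gt0_pi; rewrite divr_gt0 //= ltr_pdivrMr // mulrC.
by move/(exprn_gt0 2); lra.
Qed.

(** For 0 < i < n the angle 2 pi i / n lies strictly between 0 and 2 pi, where
the cosine is less than 1. *)
Lemma omega_primitive (R : realType) (n : nat) : (0 < n)%N ->
  n.-primitive_root (omega R n).
Proof.
move=> n0; have nR : 0 < n%:R :> R by rewrite ltr0n.
have pi0 := pi_gt0 R.
rewrite /primitive_root_of_unity n0; apply/forallP => i; apply/eqP.
rewrite unity_rootE /omega deMoivre.
have [-> | ni] := eqVneq i.+1 n.
  have -> : n%:R * (2 * pi / n%:R) = pi *+ 2 :> R.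
    by rewrite mulrC divfK ?gt_eqF // mulr_natl.
  by rewrite cos2pi sin2pi eqxx.
have iltn : (i.+1 < n)%N by rewrite ltn_neqAle ni ltn_ord.
apply/negbTE; rewrite eq_complex negb_and /= lt_eqF //; apply: cos_lt1.
rewrite mulr_gt0 ?divr_gt0 ?mulr_gt0 ?ltr0n //=.
by rewrite mulrCA mulrA ltr_pdivrMr // ltr_pM2l ?mulr_gt0 // ltr_nat.
Qed.

Unset Implicit Arguments.
Set Strict Implicit.

(** * The theorem *)

Theorem mainTheorem1 (R : realType) (n k : nat) (P : {poly R[i]})
    (n_comp : composite n) (P_neq0 : P != 0) (degP : (size P <= n)%N)
    (Pk : unity_roots_of n P #= `I_k) :
  n%:Q / (n%:Q - k%:Q) <= (weight P)%:Q
  /\ ((weight P)%:Q = n%:Q / (n%:Q - k%:Q) <->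
      exists (r l j : nat) (alpha : R[i]),
        [/\ (0 < r)%N, (r %| n)%N, (l < r)%N, (j < n)%N
          & P = alpha *: (Dpoly _ n r l \Po (omega R n ^+ j *: 'X))]).
Proof.
have n0 : (0 < n)%N by case/andP: n_comp => /ltnW.
have prz := omega_primitive R n0.
have kN := unity_roots_count prz Pk.
have nle := windows_leq
  (fun i => congr1 nat_of_bool (nonzero_at_periodic P prz i))
  (weight_windows prz P_neq0 degP).
have toD := Dpoly_of_extremal prz P_neq0 degP.
set N := (\sum_(i < n) _)%N in kN nle toD.
have N0 : (0 < N)%N by move: (leq_trans n0 nle); rewrite muln_gt0 => /andP[].
have NQ : 0 < N%:Q by rewrite ltr0n.
have -> : n%:Q - k%:Q = N%:Q by rewrite -kN PoszD intrD addrC addKr.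
split; first by rewrite ler_pdivrMr // -!pmulrn -natrM ler_nat.
have eqE : (weight P)%:Q = n%:Q / N%:Q <-> n = (weight P * N)%N.
  split=> [wE | ->]; last by rewrite PoszM intrM mulfK // gt_eqF.
  have : (weight P)%:Q * N%:Q = n%:Q by rewrite wE divfK // gt_eqF.
  by rewrite -intrM -PoszM => /intr_inj [].
split=> [/eqE/toD // | [r [l [j [a [r0 rn lr jn PE]]]]]].
apply/eqE; have a0 : a != 0 by apply: contra_neq P_neq0 => a0; rewrite PE a0 scale0r.
by have := extremal_of_Dpoly j prz a0 rn lr; rewrite /= -PE => ->.
Qed.
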